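(* Let $K = \langle S, AP, \to, L\rangle$ be an arbitrary Kripke structure. Then for all states $s, s' \in S$: $s$ and $s'$ are similar in $K$ if and only if $s$ and $s'$ are similar in the labelled transition system $\mathsf{lts}(K)$.
   Context: A Kripke structure is $K=\langle S, AP, \to, L\rangle$ with $S$ a set of states, $AP$ a set of atomic propositions, $\to\,\subseteq S\times S$ a total transition relation (for every $s\in S$ there is $t\in S$ with $s\to t$), and $L: S\to 2^{AP}$ a state labelling. A labelled transition system (LTS) is $T=\langle S, Act, \to\rangle$ with $S$ a set of states, $Act$ a set of actions, a special silent action $\tau\notin Act$, and a transition relation $\to\,\subseteq S\times(Act\cup\{\tau\})\times S$ that is total (for every $s\in S$ there are $a\in Act$, $t\in S$ with $s\xrightarrow{a}t$). The embedding $\mathsf{lts}$: for a Kripke structure $K=\langle S,AP,\to,L\rangle$, $\mathsf{lts}(K)=\langle S', Act, \to'\rangle$ where $S' = S\cup\{\bar s \mid s\in S\}$ (each $\bar s$ a fresh state not in $S$), $Act = 2^{AP}\cup\{\bot\}$ with $\bot$ a fresh symbol, and $\to'$ is the smallest relation such that: $s\xrightarrow{\bot}\bar s$ for every $s\in S$; $\bar s\xrightarrow{L(s)} s$ for every $s\in S$; $s\xrightarrow{\tau}t$ whenever $s\to t$ and $L(s)=L(t)$; $s\xrightarrow{L(t)}t$ whenever $s\to t$ and $L(s)\neq L(t)$. Simulation in a Kripke structure: a relation $B\subseteq S\times S$ is a simulation iff for all $(s,s')\in B$: $L(s)=L(s')$, and for every $t$ with $s\to t$ there is $t'$ with $s'\to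 t'$ and $(t,t')\in B$. Simulation in an LTS: $B\subseteq S\times S$ is a simulation iff for all $(s,s')\in B$, all $a\in Act\cup\{\tau\}$ and all $t$ with $s\xrightarrow{a}t$ there is $t'$ with $s'\xrightarrow{a}t'$ and $(t,t')\in B$. In either setting, states $s,s'$ are similar iff there are simulations $B$, $B'$ with $(s,s')\in B$ and $(s',s)\in B'$. *)

(* Defs.v *)
From mathcomp Require Import all_boot boolp classical_sets.

Set Implicit Arguments.
Unset Strict Implicit.
Unset Printing Implicit Defensive.

Record kripke := Kripke {
  kstate : Type;
  kprop : Type;
  ktrans : kstate -> kstate -> Prop;
  klabel : kstate -> set kprop;
  ktrans_total : forall s, exists t, ktrans s t
}.

Inductive with_tau (A : Type) := Vis of A | Tau.
Arguments Tau {A}.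

Record lts := LTS {
  lstate : Type;
  lact : Type;
  ltrans : lstate -> with_tau lact -> lstate -> Prop;
  (* the witnessing action is a visible one: it ranges over Act, not over
     the extension of Act with tau *)
  ltrans_total : forall s, exists a t, ltrans s (Vis a) t
}.

Definition kripke_simulation (K : kripke)
    (B : kstate K -> kstate K -> Prop) : Prop :=
  forall s s', B s s' ->
    klabel s = klabel s' /\
    forall t, ktrans s t -> exists t', ktrans s' t' /\ B t t'.

Definition kripke_similar (K : kripke) (s s' : kstate K) : Prop :=
  exists B B', [/\ kripke_simulation B, kripke_simulation B', B s s' & B' s' s].

Definition lts_simulation (T : lts) (B : lstate T -> lstate T -> Prop) : Prop :=
  forall s s', B s s' ->
    forall (a : with_tau (lact T)) t, ltrans s a t ->
      exists t', ltrans s' a t' /\ B t t'.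

Definition lts_similar (T : lts) (s s' : lstate T) : Prop :=
  exists B B', [/\ lts_simulation B, lts_simulation B', B s s' & B' s' s].

Inductive emb_state (S : Type) := Orig of S | Bar of S.

Inductive emb_act (AP : Type) := Lab of set AP | Bot.
Arguments Bot {AP}.

Inductive emb_trans (K : kripke) :
    emb_state (kstate K) -> with_tau (emb_act (kprop K)) ->
    emb_state (kstate K) -> Prop :=
| emb_bot s : emb_trans (Orig s) (Vis Bot) (Bar s)
| emb_lab s : emb_trans (Bar s) (Vis (Lab (klabel s))) (Orig s)
| emb_tau s t : ktrans s t -> klabel s = klabel t ->
    emb_trans (Orig s) Tau (Orig t)
| emb_step s t : ktrans s t -> klabel s <> klabel t ->
    emb_trans (Orig s) (Vis (Lab (klabel t))) (Orig t).

Lemma emb_trans_total (K : kripke) (s : emb_state (kstate K)) :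
  exists a t, emb_trans s (Vis a) t.
Proof.
case: s => s.
- by exists Bot, (Bar s); apply: emb_bot.
- by exists (Lab (klabel s)), (Orig s); apply: emb_lab.
Qed.

Definition lts_of (K : kripke) : lts := LTS (@emb_trans_total K).

(* Main.v *)
Require Import Defs.
From mathcomp Require Import all_boot boolp.

(** The two-step path [Orig s --Bot--> Bar s --Lab (klabel s)--> Orig s] makes
    the label of [s] observable, so similar states of [lts_of K] carry equal
    labels. Given equal labels at the sources, a transition of [K] and its image
    in [lts_of K] determine each other, the action recording the label of the
    target. *)

Definition emb_rel {S : Type} (B : S -> S -> Prop) (x y : emb_state S) : Prop :=
  match x, y with
  | Orig s, Orig s' | Bar s, Bar s' => B s s'
  | _, _ => False
  end.

Lemma lts_simulation_emb_rel {K : kripke} {B : kstate K -> kstate K -> Prop} :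
  kripke_simulation B -> @lts_simulation (lts_of K) (emb_rel B).
Proof.
move=> simB [s|s] [s'|s'] //= Bss' a t st; have [Ls step] := simB _ _ Bss'.
- inversion st as [u|u|u v uv Luv|u v uv Luv]; subst.
  + by exists (Bar s'); split=> //; apply: emb_bot.
  (* Related successors have equal labels [Lv]; with [Ls], the matching move is silent or visible
     alike and carries the same action. *)
  + have [v' [s'v' Bvv']] := step _ uv; have [Lv _] := simB _ _ Bvv'.
    by exists (Orig v'); split=> //; apply: emb_tau; rewrite -?Ls -?Lv.
  + have [v' [s'v' Bvv']] := step _ uv; have [Lv _] := simB _ _ Bvv'.
    by exists (Orig v'); split=> //; rewrite Lv; apply: emb_step; rewrite -?Ls -?Lv.
- inversion st; subst.
  by exists (Orig s'); split=> //; rewrite Ls; apply: emb_lab.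
Qed.

Lemma lts_simulation_klabel {K : kripke}
    {B : emb_state (kstate K) -> emb_state (kstate K) -> Prop} {s s' : kstate K} :
  @lts_simulation (lts_of K) B -> B (Orig s) (Orig s') -> klabel s = klabel s'.
Proof.
move=> simB Bss'.
have [y [s'y By]] := simB _ _ Bss' _ _ (emb_bot s).
(* [Bot] leads only to [Bar s'], whose sole action is [Lab (klabel s')]. *)
inversion s'y; subst.
have [z [yz _]] := simB _ _ By _ _ (emb_lab s).
by inversion yz.
Qed.

Lemma kripke_simulation_Orig {K : kripke}
    {B : emb_state (kstate K) -> emb_state (kstate K) -> Prop} :
  @lts_simulation (lts_of K) B ->
  kripke_simulation (fun s s' => B (Orig s) (Orig s')).
Proof.
move=> simB s s' Bss'; split=> [|t st]; first exact: lts_simulation_klabel simB Bss'.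
(* This decides which action embeds [st]; either action leads from [Orig s'] only to [Orig] of a
   successor of [s'] in [K]. *)
have [Lst|Lst] := pselect (klabel s = klabel t).
- have [y [s'y By]] := simB _ _ Bss' _ _ (emb_tau st Lst).
  by inversion s'y; subst; eexists; split; eauto.
- have [y [s'y By]] := simB _ _ Bss' _ _ (emb_step st Lst).
  by inversion s'y; subst; eexists; split; eauto.
Qed.

Theorem theorem3p5 (K : kripke) (s s' : kstate K) :
  kripke_similar s s' <-> @lts_similar (lts_of K) (Orig s) (Orig s').
Proof.
split=> -[B [B' [simB simB' Bss' B's's]]].
- by exists (emb_rel B), (emb_rel B'); split=> //; apply: lts_simulation_emb_rel.
- exists (fun u v => B (Orig u) (Orig v)), (fun u v => B' (Orig u) (Orig v)).
  by split=> //; apply: kripke_simulation_Orig.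
Qed.
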